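(* Let $n\geq 2$ and $1\leq k\leq\lfloor n/2\rfloor$ be integers, let $\alpha,\beta,\gamma,\delta>0$ be real numbers, and let $X=X_{n,k}(\alpha,\beta,\gamma,\delta)$ be an $(n,k;\alpha,\beta,\gamma,\delta)$-two-chunk cyclic metric space. For $t>0$ put $A(t)=1+(n-1)e^{-t\alpha}$, $B(t)=1+(n-1)e^{-t\beta}$, $C(t)=ke^{-t\gamma}+(n-k)e^{-t\delta}$. If $t>0$ satisfies $A(t)B(t)-C(t)^2\neq 0$, then $$\mathrm{Mag}(tX)=\frac{n\bigl(A(t)+B(t)-2C(t)\bigr)}{A(t)B(t)-C(t)^2}.$$
   Context: Magnitude: for a finite metric space $(X,d)$ with $X=\{x_1,\dots,x_m\}$, the zeta matrix is $Z_X=(e^{-d(x_i,x_j)})_{1\le i,j\le m}$. A weighting is a vector $w\in\mathbb{R}^m$ with $Z_Xw=(1,\dots,1)^T$. If a weighting exists, the magnitude is $\mathrm{Mag}(X)=\sum_{i=1}^m w_i$ for any weighting $w$ (independent of the choice, since $Z_X$ is symmetric); it is not required that $Z_X$ be invertible. For $t>0$, $tX$ denotes the metric space $(X,td)$. A distance matrix is a real symmetric matrix with zero diagonal, strictly positive off-diagonal entries, and entries satisfying all triangle inequalities $D_{ij}\le D_{i\ell}+D_{\ell j}$; it generates a finite metric space on its index set. Two-chunk cyclic spaces: for integers $n\ge 2$, $1\le k\le\lfloor n/2\rfloor$ and reals $\alpha,\beta,\gamma,\delta>0$, the $(n,k;\alpha,\beta,\gamma,\delta)$-two-chunk cyclic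 matrix $D_{n,k}(\alpha,\beta,\gamma,\delta)$ is the symmetric $2n\times 2n$ matrix indexed by $\{a_0,\dots,a_{n-1}\}\sqcup\{b_0,\dots,b_{n-1}\}$ with $D(a_i,a_i)=D(b_i,b_i)=0$, $D(a_i,a_j)=\alpha$ and $D(b_i,b_j)=\beta$ for $i\ne j$, and $D(a_i,b_j)=D(b_j,a_i)=\gamma$ if $j\equiv i+s\pmod n$ for some $s\in\{0,1,\dots,k-1\}$, and $=\delta$ otherwise. When this matrix is a distance matrix, the metric space it generates is called an $(n,k;\alpha,\beta,\gamma,\delta)$-two-chunk cyclic metric space and is denoted $X_{n,k}(\alpha,\beta,\gamma,\delta)$. *)

(* Defs.v *)
From HB Require Import structures.
From mathcomp Require Import all_boot all_order all_algebra.
From mathcomp Require Import all_classical all_reals all_analysis.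

Set Implicit Arguments.
Unset Strict Implicit.
Unset Printing Implicit Defensive.

Import Order.TTheory GRing.Theory Num.Theory.
Local Open Scope ring_scope.

#[short(type="finMetricType")]
HB.structure Definition FinMetric (R : numDomainType) :=
  { T of Finite T & Metric R T }.

Section Magnitude.
Context {R : realType}.
Implicit Type X : finMetricType R.

(* The points of X are listed as enum_val i, for i : 'I_#|X|. *)
Definition zeta_mx X : 'M[R]_#|X| :=
  \matrix_(i, j) expR (- mdist (enum_val i : X) (enum_val j : X)).

Definition is_weighting X (w : 'cV[R]_#|X|) : Prop :=
  zeta_mx X *m w = const_mx 1.

Definition has_magnitude X : Prop := exists w, is_weighting (X := X) w.

(* Meaningful only under [has_magnitude X]; by [magnitudeE] the choice of the
   weighting is then irrelevant. *)
Definition magnitude X : R :=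
  \sum_i (xget 0 [set w | is_weighting (X := X) w]%classic) i 0.

Lemma zeta_mx_sym X : (zeta_mx X)^T = zeta_mx X.
Proof. by apply/matrixP => i j; rewrite !mxE metric_sym. Qed.

Lemma weighting_sum_unique X (v w : 'cV[R]_#|X|) :
  is_weighting v -> is_weighting w -> \sum_i v i 0 = \sum_i w i 0.
Proof.
have sumE (u : 'cV[R]_#|X|) : \sum_i u i 0 = (u^T *m const_mx 1 : 'M[R]_1) 0 0.
  by rewrite mxE; apply: eq_bigr => i _; rewrite !mxE mulr1.
move=> hv hw; rewrite !sumE -{1}hw -hv mulmxA.
have -> : v^T *m zeta_mx X *m w = (w^T *m (zeta_mx X *m v))^T.
  by rewrite !trmx_mul trmxK zeta_mx_sym.
by rewrite mxE.
Qed.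

Lemma magnitudeE X (w : 'cV[R]_#|X|) :
  is_weighting w -> magnitude X = \sum_i w i 0.
Proof.
move=> hw; apply: weighting_sum_unique (hw).
exact: (@xgetPex _ _ [set v | is_weighting v]%classic (ex_intro _ w hw)).
Qed.

End Magnitude.

(* The space tX: an alias of X that carries the distance t * d. *)
Definition scaled_space (R : realType) (t : R) (t_gt0 : 0 < t)
  (X : finMetricType R) : Type := X.

Section Scaling.
Context {R : realType} (t : R) (t_gt0 : 0 < t) (X : finMetricType R).

Local Notation tX := (scaled_space t_gt0 X).

Let sdist (x y : tX) : R := t * mdist (x : X) (y : X).

Let sdistxx x : sdist x x = 0.
Proof. by rewrite /sdist mdistxx mulr0. Qed.

Let sdist_positivity x y : sdist x y = 0 -> x = y.
Proof.
move=> /eqP; rewrite mulf_eq0 gt_eqF//= => /eqP.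
exact: mdist_positivity.
Qed.

Let sdist_sym x y : sdist x y = sdist y x.
Proof. by rewrite /sdist metric_sym. Qed.

Let sdist_triangle y x z : sdist x z <= sdist x y + sdist y z.
Proof.
rewrite /sdist -mulrDr; apply: ler_wpM2l; first exact: ltW.
exact: metric_triangle. Qed.

HB.instance Definition _ := Finite.copy tX X.
HB.instance Definition _ := isMetric.Build R tX
  sdistxx sdist_positivity sdist_sym sdist_triangle.

End Scaling.

Record is_distance_mx (R : realType) (m : nat) (D : 'M[R]_m) : Prop := {
  distance_mx_sym : D^T = D;
  distance_mx_diag : forall i, D i i = 0;
  distance_mx_gt0 : forall i j, i != j -> 0 < D i j;
  distance_mx_triangle : forall i j l, D i j <= D i l + D l j }.

(* The space generated by D: an alias of its index set that carries the
   distance D. *)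
Definition generated_space (R : realType) (m : nat) (D : 'M[R]_m)
  (hD : is_distance_mx D) : Type := 'I_m.

Section GeneratedSpace.
Context {R : realType} {m : nat} (D : 'M[R]_m) (hD : is_distance_mx D).

Local Notation XD := (generated_space hD).

Let gdist (i j : XD) : R := D i j.

Let gdistxx i : gdist i i = 0.
Proof. exact: distance_mx_diag hD i. Qed.

Let gdist_positivity i j : gdist i j = 0 -> i = j.
Proof.
move=> Dij0; apply/eqP; apply: contraT => /(distance_mx_gt0 hD).
by rewrite -/(gdist i j) Dij0 ltxx.
Qed.

Let gdist_sym i j : gdist i j = gdist j i.
Proof. by rewrite /gdist -{1}(distance_mx_sym hD) mxE. Qed.

Let gdist_triangle j i l : gdist i l <= gdist i j + gdist j l.
Proof. exact: distance_mx_triangle hD i l j. Qed.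

HB.instance Definition _ := Finite.copy XD 'I_m.
HB.instance Definition _ := isMetric.Build R XD
  gdistxx gdist_positivity gdist_sym gdist_triangle.

End GeneratedSpace.

Section TwoChunkCyclic.
Context {R : realType} (n k : nat) (alpha beta gamma delta : R).

(* The block of entries D(a_i, b_j). *)
Definition cyclic_block : 'M[R]_n :=
  \matrix_(i, j)
    if [exists s : 'I_k, (j == i + s %[mod n])%N] then gamma else delta.

(* The index a_i is lshift n i and the index b_j is rshift n j. *)
Definition two_chunk_cyclic_mx : 'M[R]_(n + n) :=
  block_mx (\matrix_(i, j) if i == j then 0 else alpha) cyclic_block
           cyclic_block^T (\matrix_(i, j) if i == j then 0 else beta).

Definition two_chunk_cyclic_space (hD : is_distance_mx two_chunk_cyclic_mx) :
  finMetricType R := generated_space hD.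

End TwoChunkCyclic.

(* Main.v *)
Require Import Defs.
From mathcomp Require Import all_boot all_order all_algebra.
From mathcomp Require Import all_classical all_reals all_analysis.
From mathcomp Require Import ring.

Set Implicit Arguments.
Unset Strict Implicit.
Unset Printing Implicit Defensive.

Import Order.TTheory GRing.Theory Num.Theory.
Local Open Scope ring_scope.

(** The zeta matrix of [tX] consists of four [n * n] blocks, each with constant
    row sums: the diagonal blocks have row sums [A t] and [B t], and both
    off-diagonal blocks have row sums [C t], because every [a_i] is at distance
    [gamma] from exactly [k] of the [b_j] and, symmetrically, every [b_j] is at
    distance [gamma] from exactly [k] of the [a_i] ([card_arc_row] and
    [card_arc_col]).  A vector equal to [x] on the [a_i] and to [y] on the [b_j]
    is therefore a weighting as soon as [A x + C y = 1] and [C x + B y = 1].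
    When [A B - C ^ 2] is nonzero, Cramer's rule gives
    [x = (B - C) / (A B - C ^ 2)] and [y = (A - C) / (A B - C ^ 2)], and the
    magnitude is the total weight [n (x + y)]. *)

(** Reindexing along [enum_val], so that a weighting can be given as a function
    on the points of the space. *)
Lemma magnitude_weight_fun (R : realType) (X : finMetricType R) (f : X -> R) :
  (forall x : X, \sum_(y : X) expR (- mdist x y) * f y = 1) ->
  has_magnitude X /\ magnitude X = \sum_(x : X) f x.
Proof.
move=> hf; pose w : 'cV[R]_#|X| := \col_i f (enum_val i).
have hw : is_weighting (X := X) w.
  apply/matrixP => i j; rewrite !mxE -[RHS](hf (enum_val i)).
  rewrite [RHS](reindex (@enum_val X X)); last exact/onW_bij/enum_val_bij.
  by apply: eq_bigr => l _; rewrite !mxE.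
split; first by exists w.
rewrite (magnitudeE hw) [RHS](reindex (@enum_val X X)).
  by apply: eq_bigr => l _; rewrite mxE.
exact/onW_bij/enum_val_bij.
Qed.

(** The points and distances of [t X] unfold to indices and multiples of [D],
    so everything is read off the matrix. *)
Lemma magnitude_scaled_generated (R : realType) (m : nat) (D : 'M[R]_m)
    (hD : is_distance_mx D) (t : R) (ht : 0 < t) (f : 'I_m -> R) :
  (forall p, \sum_q expR (- (t * D p q)) * f q = 1) ->
  let X : finMetricType R := generated_space hD in
  let tX : finMetricType R := scaled_space ht X in
  has_magnitude tX /\ magnitude tX = \sum_p f p.
Proof.
by move=> hf X tX; apply: (@magnitude_weight_fun R tX f) => p; apply: hf.
Qed.

Lemma sum_if_const (R : nzRingType) (T : finType) (P : pred T) (u v : R) :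
  \sum_x (if P x then u else v) = #|P|%:R * u + (#|T| - #|P|)%:R * v.
Proof.
rewrite (bigID P) /= (eq_bigr (fun=> u)); last by move=> x ->.
rewrite [X in _ + X](eq_bigr (fun=> v)); last by move=> x /negbTE ->.
rewrite -(cardC P) addKn !sumr_const !mulr_natl; congr (_ + _ *+ _).
Qed.

Lemma card_exists_eq (T : finType) k (f : 'I_k -> T) :
  injective f -> #|[pred x | [exists s, x == f s]]| = k.
Proof.
move=> f_inj; rewrite -[RHS]card_ord -(card_codom f_inj).
apply: eq_card => x; rewrite inE.
by apply/existsP/codomP => -[s x_fs]; exists s; apply/eqP.
Qed.

(** The shifts [i + s] with [s < k] are distinct modulo [n] since [k <= n]. *)
Lemma card_arc_row n k (i : 'I_n) : (k <= n)%N ->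
  #|[pred j : 'I_n | [exists s : 'I_k, j == i + s %[mod n]]]%N| = k.
Proof.
move=> le_kn; have n_gt0 : (0 < n)%N by apply: leq_ltn_trans (ltn_ord i).
pose f (s : 'I_k) : 'I_n := Ordinal (ltn_pmod (i + s) n_gt0).
rewrite -[RHS](@card_exists_eq _ _ f).
  apply: eq_card => j; rewrite !inE; apply: eq_existsb => s.
  by rewrite -val_eqE /= (modn_small (ltn_ord j)).
move=> s s' /(congr1 val)/eqP /=; rewrite eqn_modDl.
by rewrite !modn_small ?(leq_trans (ltn_ord _) le_kn)// => /eqP/val_inj.
Qed.

(** The same count read backwards: the [i] with [j = i + s] modulo [n] are the
    shifts [j + (n - s)] with [s < k]. *)
Lemma card_arc_col n k (j : 'I_n) : (k <= n)%N ->
  #|[pred i : 'I_n | [exists s : 'I_k, j == i + s %[mod n]]]%N| = k.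
Proof.
move=> le_kn; have n_gt0 : (0 < n)%N by apply: leq_ltn_trans (ltn_ord j).
have lt_sn (s : 'I_k) : (s < n)%N := leq_trans (ltn_ord s) le_kn.
pose f (s : 'I_k) : 'I_n := Ordinal (ltn_pmod (j + (n - s)) n_gt0).
have fE (i : 'I_n) s : (i == f s) = (j == i + s %[mod n])%N.
  rewrite -val_eqE /= -{1}(modn_small (ltn_ord i)) -(eqn_modDr s).
  by rewrite -addnA subnK ?modnDr 1?eq_sym// ltnW.
rewrite -[RHS](@card_exists_eq _ _ f).
  by apply: eq_card => i; rewrite !inE; apply: eq_existsb => s; rewrite fE.
move=> s s' eq_f.
have es : (j == f s + s %[mod n])%N by rewrite -fE.
have es' : (j == f s + s' %[mod n])%N by rewrite -fE eq_f.
apply/val_inj/eqP => /=; rewrite -(modn_small (lt_sn s)) -(modn_small (lt_sn s')).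
by rewrite -[_ == _](eqn_modDl (f s)) -(eqP es) -(eqP es').
Qed.

Lemma cramer_sym (F : fieldType) (a b c : F) (d := a * b - c ^+ 2) :
  d != 0 ->
  [/\ a * ((b - c) / d) + c * ((a - c) / d) = 1,
      c * ((b - c) / d) + b * ((a - c) / d) = 1
    & (b - c) / d + (a - c) / d = (a + b - 2 * c) / d].
Proof. by rewrite /d => d_neq0; split; field. Qed.

Section BlockRowSums.
Context {R : realType} (n k : nat) (gamma delta t : R).

Lemma sum_expR_diag_block (alpha : R) (i : 'I_n) :
  \sum_j expR (- (t * (if i == j then 0 else alpha)))
    = 1 + (n - 1)%:R * expR (- (t * alpha)).
Proof.
rewrite (eq_bigr (fun j =>
  if pred1 i j then 1 else expR (- (t * alpha)))) => [|j _].
  by rewrite sum_if_const card1 card_ord mul1r.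
by rewrite /= (eq_sym j); case: eqP => // _; rewrite mulr0 oppr0 expR0.
Qed.

Lemma sum_expR_cyclic_row (i : 'I_n) : (k <= n)%N ->
  \sum_j expR (- (t * cyclic_block n k gamma delta i j))
    = k%:R * expR (- (t * gamma)) + (n - k)%:R * expR (- (t * delta)).
Proof.
move=> le_kn; have := sum_if_const
  [pred j : 'I_n | [exists s : 'I_k, j == i + s %[mod n]]]%N
  (expR (- (t * gamma))) (expR (- (t * delta))).
rewrite card_arc_row// card_ord => <-; apply: eq_bigr => j _ /=.
by rewrite mxE; case: ifP.
Qed.

Lemma sum_expR_cyclic_col (j : 'I_n) : (k <= n)%N ->
  \sum_i expR (- (t * cyclic_block n k gamma delta i j))
    = k%:R * expR (- (t * gamma)) + (n - k)%:R * expR (- (t * delta)).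
Proof.
move=> le_kn; have := sum_if_const
  [pred i : 'I_n | [exists s : 'I_k, j == i + s %[mod n]]]%N
  (expR (- (t * gamma))) (expR (- (t * delta))).
rewrite card_arc_col// card_ord => <-; apply: eq_bigr => i _ /=.
by rewrite mxE; case: ifP.
Qed.

End BlockRowSums.

Theorem proposition3p2 (R : realType) (n k : nat) (alpha beta gamma delta : R)
    (hn : (2 <= n)%N) (hk : (1 <= k <= n %/ 2)%N)
    (halpha : 0 < alpha) (hbeta : 0 < beta)
    (hgamma : 0 < gamma) (hdelta : 0 < delta)
    (hD : is_distance_mx (two_chunk_cyclic_mx n k alpha beta gamma delta)) :
  let X : finMetricType R := two_chunk_cyclic_space hD in
  let A (t : R) : R := 1 + (n - 1)%:R * expR (- (t * alpha)) in
  let B (t : R) : R := 1 + (n - 1)%:R * expR (- (t * beta)) in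
  let C (t : R) : R := k%:R * expR (- (t * gamma))
                       + (n - k)%:R * expR (- (t * delta)) in
  forall (t : R) (ht : 0 < t),
    A t * B t - C t ^+ 2 != 0 ->
    let tX : finMetricType R := scaled_space ht X in
    has_magnitude tX /\
    magnitude tX
      = n%:R * (A t + B t - 2 * C t) / (A t * B t - C t ^+ 2).
Proof.
move=> X A B C t ht; set Delta := A t * B t - C t ^+ 2 => Delta_neq0 tX.
have le_kn : (k <= n)%N.
  by case/andP: hk => _ /leq_trans; apply; apply: leq_div.
pose x : R := (B t - C t) / Delta; pose y : R := (A t - C t) / Delta.
pose f (p : 'I_(n + n)) : R := if fintype.split p is inl _ then x else y.
have fl i : f (lshift n i) = x by rewrite /f (unsplitK (inl i)).
have fr i : f (rshift n i) = y by rewrite /f (unsplitK (inr i)).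
have [eq_a eq_b sum_xy] := cramer_sym Delta_neq0.
rewrite -/Delta -/x -/y in eq_a eq_b sum_xy.
pose D := two_chunk_cyclic_mx n k alpha beta gamma delta.
have row_sum (p : 'I_(n + n)) : \sum_q expR (- (t * D p q)) * f q = 1.
  rewrite big_split_ord /=; under eq_bigr do rewrite fl.
  under [X in _ + X]eq_bigr do rewrite fr.
  rewrite -!mulr_suml; case: (split_ordP p) => i ->.
    under eq_bigr do rewrite block_mxEul mxE.
    under [X in _ + X * _]eq_bigr do rewrite block_mxEur.
    by rewrite sum_expR_diag_block sum_expR_cyclic_row.
  under eq_bigr do rewrite block_mxEdl mxE.
  under [X in _ + X * _]eq_bigr do rewrite block_mxEdr mxE.
  by rewrite sum_expR_cyclic_col// sum_expR_diag_block.
have [hasM ->] := magnitude_scaled_generated hD ht row_sum.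
split=> //; rewrite big_split_ord /=; under eq_bigr do rewrite fl.
under [X in _ + X]eq_bigr do rewrite fr.
by rewrite !sumr_const card_ord -mulrnDl sum_xy -[LHS]mulr_natl mulrA.
Qed.
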